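(* Let $f\colon\mathbb{R}^n\to\mathbb{R}\cup\{+\infty\}$ be a lower semi-continuous semi-algebraic function and let $S\subset\mathbb{R}^n$ be a closed semi-algebraic set such that $\mathrm{dom} f\cap S$ is nonempty and unbounded. Assume that the qualification condition $(\mathrm{QC})$ holds. Then $$\inf_{x\in S}f(x)=\min\left\{\min_{x\in\Sigma(f,S)}f(x),\ \min_{k=1,\ldots,p}\lambda_k\right\}.$$
   Context: Conventions. $\inf\emptyset=+\infty$ (also for minima over empty sets). $\|\cdot\|$ is the Euclidean norm on $\mathbb{R}^n$; $\mathbb{B}_R$ and $\mathbb{S}_R$ are the closed ball and the sphere of radius $R>0$ centered at $0$. A subset of $\mathbb{R}^n$ is semi-algebraic if it is a finite union of sets, each defined by finitely many polynomial equalities and strict inequalities; a map is semi-algebraic if its graph is (for $f\colon\mathbb{R}^n\to\mathbb{R}\cup\{+\infty\}$ the graph is $\{(x,y)\in\mathbb{R}^n\times\mathbb{R}\mid y=f(x)\}$). $\mathrm{dom} f=\{x\mid f(x)<+\infty\}$, $\mathrm{epi} f=\{(x,\alpha)\in\mathbb{R}^n\times\mathbb{R}\mid f(x)\le\alpha\}$. Normals and subdifferentials. For $x\in S\subset\mathbb{R}^n$, the regular normal cone $\widehat N(x;S)$ is the set of $v$ with $\langle v,x'-x\rangle\le o(\|x'-x\|)$ as $x'\to x$, $x'\in S$. The limiting normal cone $N(x;S)$ is the set of $v$ for which there are $x_k\to x$, $x_k\in S$, and $v_k\to v$ with $v_k\in\widehat N(x_k;S)$. For $x\in\mathrm{dom}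 f$: $\partial f(x)=\{v\mid (v,-1)\in N((x,f(x));\mathrm{epi} f)\}$ and $\partial^\infty f(x)=\{v\mid (v,0)\in N((x,f(x));\mathrm{epi} f)\}$. $(\mathrm{QC})$: $\partial^\infty f(x)\cap(-N(x;S))=\{0\}$ for all $x\in\mathrm{dom} f\cap S$. Critical points: $\Sigma(f,S)=\{x\in\mathrm{dom} f\cap S\mid 0\in\partial f(x)+N(x;S)\}$; $f(\Sigma(f,S))$ is a finite subset of $\mathbb{R}$. Tangency variety: $\Gamma(f,S)=\{x\in\mathrm{dom} f\cap S\mid \exists\mu\in\mathbb{R}:\ 0\in\partial f(x)+N(x;S)+\mu x\}$ (a semi-algebraic set). Decomposition at infinity. Fix a finite partition of $\Gamma(f,S)$ into semi-algebraic sets $C_1,\ldots,C_\ell$ on each of which $f$ is continuous. By Hardt's triviality theorem applied to $x\mapsto\|x\|$ on $\Gamma(f,S)$, there are $R>0$, semi-algebraic sets $F_1,\ldots,F_\ell$ and a semi-algebraic homeomorphism $h\colon(\cup_i F_i)\times(R,+\infty)\to\Gamma(f,S)\setminus\mathbb{B}_R$ with $\|h(x,t)\|=t$ and $h(F_i\times(R,+\infty))=C_i\setminus\mathbb{B}_R$ for all $i$. Let $\Gamma_1,\ldots,\Gamma_p$ be the sets $h(F'\times(R,+\infty))$, with $F'$ running over the connected components of $F_1,\ldots,F_\ell$. Thus $\Gamma(f,S)\setminus\mathbb{B}_R$ is the disjoint union of the semi-algebraic sets $\Gamma_k$; each $\Gamma_k$ is connected and unbounded, $\Gamma_k\cap\mathbb{S}_t$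 is nonempty and connected for each $t>R$, and $f|_{\Gamma_k}$ is continuous. $R$ may be increased to $R'$ by restricting $h$, i.e. replacing $\Gamma_k$ by $\Gamma_k\setminus\mathbb{B}_{R'}$. Under $(\mathrm{QC})$, for $R$ large enough $f$ is constant on each $\Gamma_k\cap\mathbb{S}_t$, $t>R$, so $f_k\colon(R,+\infty)\to\mathbb{R}$, $f_k(t):=f(x)$ for any $x\in\Gamma_k\cap\mathbb{S}_t$, is well defined; it is semi-algebraic, hence $\lambda_k:=\lim_{t\to+\infty}f_k(t)\in\mathbb{R}\cup\{\pm\infty\}$ exists. $R$ is fixed sufficiently large (the claim is for all sufficiently large $R$). *)

(* Defs.v *)
From HB Require Import structures.
From mathcomp Require Import all_boot all_order all_algebra.
From mathcomp Require Import all_classical all_reals all_analysis.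
(* Not imported: the notations of mpoly clash with those of analysis. *)
From mathcomp Require mpoly.

Set Implicit Arguments.
Unset Strict Implicit.
Unset Printing Implicit Defensive.

Import Order.TTheory GRing.Theory Num.Theory.
Import numFieldNormedType.Exports.

Local Open Scope classical_set_scope.
Local Open Scope ring_scope.

(* Points of R^n are row vectors. The library norm on 'rV[R]_n is the sup
   norm; it induces the usual topology, but the Euclidean norm is needed for
   balls and spheres. *)
Section Euclidean.
Context {R : realType} {n : nat}.
Implicit Types x y : 'rV[R]_n.

Definition dotv x y : R := \sum_(i < n) x 0 i * y 0 i.

Definition enorm x : R := Num.sqrt (dotv x x).

Definition eball (r : R) : set 'rV[R]_n := [set x | enorm x <= r].

Definition esphere (r : R) : set 'rV[R]_n := [set x | enorm x = r].

End Euclidean.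

Section SemiAlgebraic.
Context {R : realType}.

(* A pair (ps, qs) stands for the system p = 0 (p in ps), 0 < q (q in qs). *)
Definition satisfies_system {N : nat} (x : 'rV[R]_N)
    (sys : seq (mpoly.mpoly N R) * seq (mpoly.mpoly N R)) : bool :=
  all (fun p => mpoly.meval (fun i => x 0 i) p == 0) sys.1 &&
  all (fun q => 0 < mpoly.meval (fun i => x 0 i) q) sys.2.

Definition semialgebraic {N : nat} (A : set 'rV[R]_N) : Prop :=
  exists L : seq (seq (mpoly.mpoly N R) * seq (mpoly.mpoly N R)),
    A = [set x | has (satisfies_system x) L].

Definition semialgebraic_efun {n : nat} (f : 'rV[R]_n -> \bar R) : Prop :=
  semialgebraic [set z : 'rV[R]_(n + 1) | f (lsubmx z) = (rsubmx z 0 0)%:E].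

(* Semi-algebraicity of a map defined on a subset A of R^m x R. *)
Definition semialgebraic_map_on {m n : nat} (A : set ('rV[R]_m * R))
    (h : 'rV[R]_m * R -> 'rV[R]_n) : Prop :=
  semialgebraic [set row_mx (row_mx a.1 (const_mx a.2 : 'rV[R]_1)) (h a)
                | a in A].

End SemiAlgebraic.

Section Variational.
Context {R : realType}.

Definition regular_normal {n : nat} (S : set 'rV[R]_n) (x : 'rV[R]_n) :
    set 'rV[R]_n :=
  [set v | forall e : R, 0 < e ->
     \forall y \near within S (nbhs x), dotv v (y - x) <= e * enorm (y - x)].

Definition limiting_normal {n : nat} (S : set 'rV[R]_n) (x : 'rV[R]_n) :
    set 'rV[R]_n :=
  [set v | exists xs vs : nat -> 'rV[R]_n,
     [/\ forall k, S (xs k), xs @ \oo --> x, vs @ \oo --> v &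
         forall k, regular_normal S (xs k) (vs k)]].

Context {n : nat}.
Implicit Types (f : 'rV[R]_n -> \bar R) (S : set 'rV[R]_n).

Definition edom f : set 'rV[R]_n := [set x | (f x < +oo)%E].

Definition epi f : set 'rV[R]_(n + 1) :=
  [set z | (f (lsubmx z) <= (rsubmx z 0 0)%:E)%E].

(* The two subdifferentials are only meant at points where f is finite. *)
Definition subdiff f (x : 'rV[R]_n) : set 'rV[R]_n :=
  [set v | limiting_normal (epi f)
             (row_mx x (const_mx (fine (f x)))) (row_mx v (const_mx (-1)))].

Definition singular_subdiff f (x : 'rV[R]_n) : set 'rV[R]_n :=
  [set v | limiting_normal (epi f)
             (row_mx x (const_mx (fine (f x)))) (row_mx v (const_mx 0))].

Definition qualification f S : Prop :=
  forall x, edom f x -> S x ->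
    singular_subdiff f x `&` [set v | limiting_normal S x (- v)] = [set 0].

Definition critical_points f S : set 'rV[R]_n :=
  [set x | [/\ edom f x, S x &
     exists u v, [/\ subdiff f x u, limiting_normal S x v & u + v = 0]]].

Definition tangency_variety f S : set 'rV[R]_n :=
  [set x | [/\ edom f x, S x &
     exists (mu : R) u v,
       [/\ subdiff f x u, limiting_normal S x v & u + v + mu *: x = 0]]].

End Variational.

Definition homeomorphism_on {T U : topologicalType} (A : set T) (B : set U)
    (h : T -> U) : Prop :=
  [/\ set_bij A B h, {within A, continuous h} &
      exists2 g : U -> T,
        {within B, continuous g} & forall a, A a -> g (h a) = a].

(* A decomposition at infinity of the tangency variety: a finite
   semi-algebraic partition [piece] of it with f continuous on each piece, a
   Hardt trivialization [triv] of the Euclidean norm beyond [base_radius], with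
   fibres [fibre i] in some R^m, compatible with the pieces, and an enumeration
   [component] without repetition of all the connected components of the
   fibres. *)
Record decomposition_at_infinity {R : realType} {n : nat}
    (f : 'rV[R]_n -> \bar R) (S : set 'rV[R]_n) := DecompositionAtInfinity {
  pieces : nat;
  piece : 'I_pieces -> set 'rV[R]_n;
  piece_partition :
    classical_sets.partition setT piece (tangency_variety f S);
  piece_semialgebraic : forall i, semialgebraic (piece i);
  piece_continuous : forall i, {within piece i, continuous f};
  base_radius : R;
  base_radius_gt0 : 0 < base_radius;
  fibre_dim : nat;
  fibre : 'I_pieces -> set 'rV[R]_fibre_dim;
  fibre_semialgebraic : forall i, semialgebraic (fibre i);
  triv : 'rV[R]_fibre_dim * R -> 'rV[R]_n;
  triv_homeomorphism : homeomorphism_on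
    ((\bigcup_i fibre i) `*` `]base_radius, +oo[)
    (tangency_variety f S `\` eball base_radius) triv;
  triv_semialgebraic : semialgebraic_map_on
    ((\bigcup_i fibre i) `*` `]base_radius, +oo[) triv;
  triv_norm : forall a t,
    (\bigcup_i fibre i) a -> base_radius < t -> enorm (triv (a, t)) = t;
  triv_piece : forall i,
    triv @` (fibre i `*` `]base_radius, +oo[) = piece i `\` eball base_radius;
  components : nat;
  component : 'I_components -> set 'rV[R]_fibre_dim;
  component_inj : injective component;
  component_range : range component =
    \bigcup_i [set connected_component (fibre i) a | a in fibre i]
}.

Arguments base_radius {R n f S} _.
Arguments triv {R n f S} _ _.
Arguments components {R n f S} _.
Arguments component {R n f S} _ _.

Definition tangency_branch {R : realType} {n : nat} {f : 'rV[R]_n -> \bar R}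
    {S : set 'rV[R]_n} (D : decomposition_at_infinity f S)
    (k : 'I_(components D)) : set 'rV[R]_n :=
  triv D @` (component D k `*` `]base_radius D, +oo[).

Arguments tangency_branch {R n f S} _ _.

(* Main.v *)
Require Import Defs.
From mathcomp Require Import all_boot all_order all_algebra.
From mathcomp Require Import all_classical all_reals all_analysis.
From mathcomp Require Import ring lra.
From mathcomp Require mpoly polyrcf qe_rcf.
From mathcomp Require Import ordered_qelim.

Set Implicit Arguments.
Unset Strict Implicit.
Unset Printing Implicit Defensive.

Import Order.TTheory GRing.Theory Num.Theory.
Import numFieldNormedType.Exports.

Local Open Scope classical_set_scope.
Local Open Scope ring_scope.

(** The inequality from left to right is formal: critical points and branches
    consist of points of S. It only needs the limits [lambda_k] to exist, and
    they do because, for every real [c], the set of [t] with [f_k t < c] is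
    first-order definable over the reals: by quantifier elimination it is
    eventually everything or eventually nothing ([eventually_holds]), and a
    function with this property for all [c] has a limit in the extended reals.

    For the other inequality let m be the infimum of f over S, and let y in S
    have value less than c, where m < c. Minimize over S
      f(x) + K * max(|x|^2 - |y|^2, 0)^2
    in the ball |x|^2 <= |y|^2 + 1. The penalty vanishes at y, so the minimizer
    x has value less than c; for K large the penalty on the sphere is too
    expensive, so x is interior. The gradient of the penalty is a multiple of x,
    hence the sum rule for limiting subdifferentials, applied to f and S, says
    precisely that x is a point of the tangency variety
    ([tangency_point_below]). Using a penalty inside a ball, and not a sphere as
    a constraint, makes the qualification condition on f and S the right one for
    this step.

    Let c tend to m. If these tangency points remain in a ball, f attains m on
    S, at a point that is critical by the sum rule. Otherwise there are
    tangency points with values close to m at arbitrarily large distance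
    ([far_tangency_point_below]); they lie on finitely many branches, and if all
    the limits exceeded m then some c > m would eventually be below every f_k.

    The sum rule itself ([subdiff_sum_rule]) is obtained by decoupling: the term
    k|x - y|^2, with x ranging over the domain of f and y over S, replaces the
    constraint x = y. The first-order conditions at minimizers give regular
    normals to the epigraph of f and to S with opposite multipliers w_k. If
    these stay bounded they converge to the required normals; if not, their
    normalizations converge to a direction that the qualification condition
    forbids. *)

(** * Euclidean structure of row vectors *)

Section Euclid.
Context {R : realType}.

Lemma dotvC n (x y : 'rV[R]_n) : dotv x y = dotv y x.
Proof. by apply: eq_bigr => i _; rewrite mulrC. Qed.

Lemma dotvDl n (x y z : 'rV[R]_n) : dotv (x + y) z = dotv x z + dotv y z.
Proof. by rewrite -big_split; apply: eq_bigr => i _; rewrite !mxE mulrDl. Qed.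

Lemma dotvZl n a (x y : 'rV[R]_n) : dotv (a *: x) y = a * dotv x y.
Proof. by rewrite mulr_sumr; apply: eq_bigr => i _; rewrite !mxE mulrA. Qed.

Lemma dotvDr n (x y z : 'rV[R]_n) : dotv z (x + y) = dotv z x + dotv z y.
Proof. by rewrite dotvC dotvDl !(dotvC z). Qed.

Lemma dotvZr n a (x y : 'rV[R]_n) : dotv x (a *: y) = a * dotv x y.
Proof. by rewrite dotvC dotvZl dotvC. Qed.

Lemma dotvNl n (x y : 'rV[R]_n) : dotv (- x) y = - dotv x y.
Proof. by rewrite -scaleN1r dotvZl mulN1r. Qed.

Lemma dotvNr n (x y : 'rV[R]_n) : dotv x (- y) = - dotv x y.
Proof. by rewrite dotvC dotvNl dotvC. Qed.

Definition dotvE := (dotvDl, dotvDr, dotvNl, dotvNr, dotvZl, dotvZr).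

Lemma dotv0r n (x : 'rV[R]_n) : dotv x 0 = 0.
Proof. by rewrite -(scale0r 0) dotvZr mul0r. Qed.

Lemma dotv_row_mx n p (a c : 'rV[R]_n) (b d : 'rV[R]_p) :
  dotv (row_mx a b) (row_mx c d) = dotv a c + dotv b d.
Proof.
rewrite /dotv big_split_ord; congr (_ + _); apply: eq_bigr => i _.
  by rewrite !row_mxEl.
by rewrite !row_mxEr.
Qed.

Lemma dotv_const_mx (a b : R) : dotv (const_mx a) (const_mx b : 'rV_1) = a * b.
Proof. by rewrite /dotv big_ord1 !mxE. Qed.

Lemma dotv_ge0 n (x : 'rV[R]_n) : 0 <= dotv x x.
Proof. by apply: sumr_ge0 => i _; rewrite -expr2 sqr_ge0. Qed.

Lemma sqr_coord_le_dotv n (x : 'rV[R]_n) i : x 0 i ^+ 2 <= dotv x x.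
Proof.
rewrite /dotv (bigD1 i) //= -expr2 lerDl.
by apply: sumr_ge0 => j _; rewrite -expr2 sqr_ge0.
Qed.

Lemma norm_le_enorm n (x : 'rV[R]_n) : `|x| <= enorm x.
Proof.
rewrite /Num.norm /= mx_normrE; apply/bigmax_leP; split; first exact: sqrtr_ge0.
move=> [i j] _ /=; rewrite (ord1 i) -sqrtr_sqr ler_wsqrtr //.
exact: sqr_coord_le_dotv.
Qed.

Lemma dotv_eq0 n (x : 'rV[R]_n) : dotv x x = 0 -> x = 0.
Proof.
move=> x0; apply/rowP => i; rewrite mxE; apply/eqP.
by rewrite -(sqrf_eq0 (x 0 i)) eq_le sqr_ge0 -x0 sqr_coord_le_dotv.
Qed.

Lemma enorm_sqr n (x : 'rV[R]_n) : enorm x ^+ 2 = dotv x x.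
Proof. by rewrite sqr_sqrtr // dotv_ge0. Qed.

Lemma enorm_le n (r : R) (x : 'rV[R]_n) :
  0 <= r -> (enorm x <= r) = (dotv x x <= r ^+ 2).
Proof. by move=> r0; rewrite -enorm_sqr ler_pXn2r // nnegrE ?sqrtr_ge0. Qed.

(** Expanding the squared norm of <y,y> x - <x,y> y, which is nonnegative. *)
Lemma cauchy_schwarz n (x y : 'rV[R]_n) :
  dotv x y ^+ 2 <= dotv x x * dotv y y.
Proof.
have [/dotv_eq0 ->|y0] := eqVneq (dotv y y) 0.
  by rewrite !dotv0r expr0n mulr0.
have yp : 0 < dotv y y by rewrite lt0r y0 dotv_ge0.
have := dotv_ge0 (dotv y y *: x - dotv x y *: y).
rewrite !dotvE (dotvC y x); set a := dotv x y; set b := dotv x x.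
set c := dotv y y in yp *.
by move=> h; rewrite -(ler_pM2l yp); lra.
Qed.

Lemma cvg_dotv I (F : set_system I) {FF : Filter F} n (x y : I -> 'rV[R]_n)
    l m :
  x @ F --> l -> y @ F --> m -> dotv (x i) (y i) @[i --> F] --> dotv l m.
Proof.
move=> xl ym; apply: cvg_big => [|i _]; first exact: add_continuous.
by apply: cvgM; [exact: cvg_comp xl (@coord_continuous _ _ _ 0 i l)|
                 exact: cvg_comp ym (@coord_continuous _ _ _ 0 i m)].
Qed.

Lemma dotvB_continuous n (c : 'rV[R]_n) :
  continuous (fun y : 'rV[R]_n => dotv (y - c) (y - c)).
Proof.
move=> x; have xc : y - c @[y --> x] --> x - c.
  exact: cvgB cvg_id (cvg_cst _).
exact: (cvg_dotv xc xc).
Qed.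

Lemma near_dotvB n (x : 'rV[R]_n) (e : R) :
  0 < e -> \forall y \near x, dotv (y - x) (y - x) < e.
Proof.
move=> e0; apply: (cvgr_lt _ (@dotvB_continuous n x x)).
by rewrite subrr dotv0r.
Qed.

Lemma nbhs_dotvB n (x : 'rV[R]_n) (A : set 'rV[R]_n) : nbhs x A ->
  exists2 e : R, 0 < e & forall y, dotv (y - x) (y - x) <= e -> A y.
Proof.
move=> /nbhs_ballP[e /= e0 eA]; exists ((e / 2) ^+ 2).
  by rewrite exprn_gt0 // divr_gt0.
move=> y ye; apply: eA; rewrite -ball_normE /= distrC.
apply: le_lt_trans (norm_le_enorm _) _.
apply: (@le_lt_trans _ _ (e / 2)); last first.
  by rewrite ltr_pdivrMr // ltr_pMr // ltr1n.
by rewrite enorm_le // ltW // divr_gt0.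
Qed.

Lemma compact_dotvB n (c : 'rV[R]_n) (r : R) :
  compact [set y | dotv (y - c) (y - c) <= r].
Proof.
apply: bounded_closed_compact.
  exists (Num.sqrt r + `|c|); split; first exact: num_real.
  move=> M hM x /= xr; apply: le_trans (ltW hM).
  rewrite -lerBlDr; apply: le_trans (lerB_dist _ _) _.
  by apply: le_trans (norm_le_enorm _) _; rewrite ler_wsqrtr.
have /continuous_closedP cl := @dotvB_continuous n c.
exact: cl (@closed_le _ r).
Qed.

End Euclid.

(** * Lower semicontinuity and compactness *)

Section LowerSemicontinuity.
Context {R : realType}.
Local Open Scope ereal_scope.

Lemma ereal_lt_between (x y : \bar R) :
  x < y -> exists2 c : R, x < c%:E & c%:E < y.
Proof.
case: x y => [r| |] [s| |] //; rewrite ?lte_fin.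
- by move=> rs; exists ((r + s) / 2)%R; rewrite lte_fin; lra.
- by exists (r + 1)%R; rewrite ?ltry // lte_fin ltrDl.
- by exists (s - 1)%R; rewrite ?ltNyr // lte_fin gtrBl.
- by exists 0%R; rewrite ?ltNyr ?ltry.
Qed.

(** The sublevel sets of f in K, taken at the values of f, form a filter base;
    its cluster points are minimizers, as f stays above any real level smaller
    than f p on a neighbourhood of p. *)
Lemma lsc_compact_min (T : topologicalType) (f : T -> \bar R) (K : set T) :
  lower_semicontinuous f -> compact K -> K !=set0 ->
  exists2 x, K x & forall y, K y -> f x <= f y.
Proof.
move=> fl Kc [x0 Kx0].
pose B (c : T) := [set y | K y /\ f y <= f c].
have FB : ProperFilter (filter_from K B).
  apply: filter_from_proper; last by move=> c Kc'; exists c; split.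
  apply: filter_from_filter; first by exists x0.
  move=> c d Kc' Kd; have [cd|dc] := leP (f c) (f d).
    by exists c => // y [Ky yc]; do 2?split=> //; exact: le_trans yc cd.
  by exists d => // y [Ky yd]; do 2?split=> //; exact: le_trans yd (ltW dc).
have [|p [Kp pcl]] := Kc _ FB; first by exists x0 => // y [].
exists p => // y Ky; rewrite leNgt; apply/negP => fyp.
have [a ya ap] := ereal_lt_between fyp.
have [V Vp aV] := fl p a ap.
have [|z [[Kz zy] Vz]] := pcl (B y) V _ Vp; first by exists y.
by have := lt_le_trans (aV z Vz) (ltW (le_lt_trans zy ya)); rewrite ltxx.
Qed.

(** The strict gap between a and f x + g x can be shared: choose a real b
    between a - g x and f x, so that f stays above b and g above a - b. *)
Lemma lsc_addC (T : topologicalType) (f : T -> \bar R) (g : T -> R) :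
  (forall x, -oo < f x) -> lower_semicontinuous f -> continuous g ->
  lower_semicontinuous (fun x => f x + (g x)%:E).
Proof.
move=> fN fl gc x a axg.
have [b afb bf] : exists2 b : R, (a - g x < b)%R & b%:E < f x.
  move: axg (fN x); case: (f x) => [r| |] //.
    rewrite -EFinD lte_fin => h _; exists ((a - g x + r) / 2)%R.
      lra.
    by rewrite lte_fin; lra.
  by move=> _ _; exists (a - g x + 1)%R; [rewrite ltrDl|rewrite ltry].
have [V Vx bV] := fl x b bf.
have gV : \forall y \near x, (a - b < g y)%R.
  by apply: (cvgr_gt _ (gc x)); rewrite ltrBlDr -ltrBlDl.
exists (V `&` [set y | (a - b < g y)%R]); first exact: filterI.
move=> y [Vy] /= aby; have := bV y Vy; move: (fN y).
case: (f y) => [r| |] //.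
  by rewrite -EFinD !lte_fin => _ ?; lra.
by move=> _ _; rewrite addye // ltry.
Qed.

Lemma lsc_comp (T U : topologicalType) (f : U -> \bar R) (h : T -> U) :
  lower_semicontinuous f -> continuous h -> lower_semicontinuous (f \o h).
Proof.
move=> fl hc x a /= /fl[V Vx aV]; exists (h @^-1` V) => [|y Vy].
  exact: hc.
exact: aV.
Qed.

Lemma lsc_sublevel_closed (T : topologicalType) (f : T -> \bar R) (a : R) :
  lower_semicontinuous f -> closed [set x | f x <= a%:E].
Proof.
move=> /lower_semicontinuousP/(_ a) fo; rewrite -openC; congr (open _): fo.
by apply/seteqP; split=> x /=; rewrite ltNge => /negP.
Qed.

(** This replaces the extraction of successive subsequences: along one
    ultrafilter all the bounded families of a proof converge at once. *)
Lemma compact_ultra_cvg I (G : set_system I) {GU : UltraFilter G}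
    (T : topologicalType) (K : set T) (x : I -> T) :
  compact K -> (\forall i \near G, K (x i)) -> exists2 p, K p & x @ G --> p.
Proof.
move=> Kc Kx; have [p [Kp pcl]] := Kc (x @ G) _ Kx; exists p => // V Vp.
have [//|nV] := in_ultra_setVsetC (x @^-1` V) GU.
have [z []] := pcl (~` V) V nV Vp; by [].
Qed.

End LowerSemicontinuity.

(** * Regular and limiting normals *)

Section NormalCones.
Context {R : realType}.

(** First-order condition at a constrained minimum: a quadratic remainder is
    below e |y - x| as soon as |C| |y - x| <= e. *)
Lemma regular_normal_quadratic n (S : set 'rV[R]_n) (x g : 'rV[R]_n) (C : R) :
  (\forall y \near x,
     S y -> 0 <= dotv g (y - x) + C * dotv (y - x) (y - x)) ->
  regular_normal S x (- g).
Proof.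
move=> gC e e0; have C0 : 0 < `|C| + 1 by rewrite ltr_wpDl.
have d0 : 0 < (e / (`|C| + 1)) ^+ 2 by rewrite exprn_gt0 // divr_gt0.
apply: filterS2 gC (near_dotvB x d0) => y gC yx Sy.
have N0 : 0 <= enorm (y - x) by exact: sqrtr_ge0.
have {yx} : enorm (y - x) < e / (`|C| + 1).
  by rewrite -(@ltr_pXn2r _ 2) ?nnegrE ?enorm_sqr // ltW // divr_gt0.
rewrite ltr_pdivlMr // => yx.
have := gC Sy; rewrite dotvNl -enorm_sqr.
have := ler_norm C; set N := enorm _ in N0 yx *; set c := `|C| in C0 yx *.
move=> Cc; nra.
Qed.

Lemma regular_normalZ n (S : set 'rV[R]_n) x v (a : R) :
  0 < a -> regular_normal S x v -> regular_normal S x (a *: v).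
Proof.
move=> a0 vN e e0; have := vN (e / a) (divr_gt0 e0 a0); apply: filterS => y.
by rewrite dotvZl mulrAC ler_pdivlMr // mulrC.
Qed.

(** Diagonal extraction: convergence along an arbitrary filter of points and
    regular normals is enough to produce the sequences of the definition. *)
Lemma limiting_normal_cvg I (G : set_system I) {GF : ProperFilter G} n
    (S : set 'rV[R]_n) (x v : 'rV[R]_n) (xs vs : I -> 'rV[R]_n) :
  (\forall i \near G, S (xs i) /\ regular_normal S (xs i) (vs i)) ->
  xs @ G --> x -> vs @ G --> v -> limiting_normal S x v.
Proof.
move=> SG xx vv.
have /choice[i iP] : forall k : nat, exists i,
    [/\ S (xs i), regular_normal S (xs i) (vs i),
        `|x - xs i| < k.+1%:R^-1 & `|v - vs i| < k.+1%:R^-1].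
  move=> k; have k0 : 0 < k.+1%:R^-1 :> R by rewrite invr_gt0.
  have xk : \forall i \near G, `|x - xs i| < k.+1%:R^-1 by exact: cvgr_dist_lt.
  have vk : \forall i \near G, `|v - vs i| < k.+1%:R^-1 by exact: cvgr_dist_lt.
  have [i [[[? ?] ?] ?]] := filter_ex (filterI (filterI SG xk) vk).
  by exists i.
have small (e : R) : 0 < e -> \forall k \near \oo, k.+1%:R^-1 < e.
  by move=> e0; exact: (near_infty_natSinv_lt (PosNum e0)).
exists (xs \o i), (vs \o i); split.
- by move=> k; have [] := iP k.
- apply/cvgrPdist_lt => e /small; apply: filterS => k.
  by apply: lt_trans; have [] := iP k.
- apply/cvgrPdist_lt => e /small; apply: filterS => k.
  by apply: lt_trans; have [] := iP k.
- by move=> k; have [] := iP k.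
Qed.

Lemma limiting_normalZ n (S : set 'rV[R]_n) x v (a : R) :
  0 < a -> limiting_normal S x v -> limiting_normal S x (a *: v).
Proof.
move=> a0 [xs [vs [Sx xx vv N]]]; exists xs, (fun k => a *: vs k); split=> //.
  exact: cvgZr.
by move=> k; exact: regular_normalZ.
Qed.

Lemma cvg_row_mx_const I (F : set_system I) {FF : Filter F} n
    (u : I -> 'rV[R]_n) (t : I -> R) (u0 : 'rV[R]_n) (t0 : R) :
  u @ F --> u0 -> t @ F --> t0 ->
  row_mx (u i) (const_mx (t i) : 'rV_1) @[i --> F] --> row_mx u0 (const_mx t0).
Proof.
move=> uu tt; apply/cvg_ballP => e e0.
have ue : \forall i \near F, ball u0 e (u i) by move/cvg_ballP : uu; exact.
have te : \forall i \near F, ball t0 e (t i) by move/cvg_ballP : tt; exact.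
apply: filterS2 ue te => i [_ ui] ti; split=> // a j; rewrite !mxE.
by case: (fintype.split j) => k; [exact: ui|rewrite !mxE; exact: ti].
Qed.

End NormalCones.

(** * The sum rule under the qualification condition *)

Section SumRule.
Context {R : realType}.

(** The smooth term enters only through a quadratic majorant at the minimizer,
    with gradient g there. All the perturbations are then quadratic, and their
    increments are computed exactly instead of estimated. *)
Lemma subdiff_sum_rule n (f : 'rV[R]_n -> \bar R) (S : set 'rV[R]_n)
    (xb g : 'rV[R]_n) (C : R) :
  (forall x, -oo < f x)%E -> lower_semicontinuous f -> closed S ->
  edom f xb -> S xb ->
  singular_subdiff f xb `&` [set v | limiting_normal S xb (- v)] `<=` [set 0] ->
  0 <= C ->
  (\forall y \near xb, S y ->
     f xb <= f y + (dotv g (y - xb) + C * dotv (y - xb) (y - xb))%:E)%E ->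
  exists u v, [/\ subdiff f xb u, limiting_normal S xb v & u + v + g = 0].
Proof.
move=> fN fl Sc fxb Sxb QC C0 /nbhs_dotvB[r r0 xbmin].
set ab := fine (f xb).
have fab : f xb = ab%:E by rewrite fineK // fin_numE -ltNye -ltey fN.
pose B := [set y : 'rV[R]_n | dotv (y - xb) (y - xb) <= r].
have Bc : compact B := @compact_dotvB _ _ xb r.
have Bxb : B xb by rewrite /B /= subrr dotv0r ltW.
(* C + 1 instead of C makes xb the only minimizer. *)
pose l (x : 'rV[R]_n) := dotv g (x - xb) + (C + 1) * dotv (x - xb) (x - xb).
have gc : continuous (fun x : 'rV[R]_n => dotv g (x - xb)).
  move=> x; have xc : y - xb @[y --> x] --> x - xb.
    exact: cvgB cvg_id (cvg_cst _).
  exact: (cvg_dotv (cvg_cst g) xc).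
have lc : continuous l.
  move=> x; have q := @dotvB_continuous _ _ xb x.
  exact: (cvgD (@gc x) (cvgM (cvg_cst (C + 1)) q)).
pose phi (k : nat) (z : 'rV[R]_n * 'rV[R]_n) :=
  l z.1 + k%:R * dotv (z.1 - z.2) (z.1 - z.2).
have phi_cvg I (F : set_system I) (FF : Filter F) k u v (c d : 'rV[R]_n) :
    u @ F --> c -> v @ F --> d -> phi k (u i, v i) @[i --> F] --> phi k (c, d).
  move=> uc vd.
  have l1 : l (u i) @[i --> F] --> l c by exact: cvg_comp uc (@lc c).
  have uv : u i - v i @[i --> F] --> c - d by exact: cvgB.
  have q : dotv (u i - v i) (u i - v i) @[i --> F] --> dotv (c - d) (c - d).
    exact: cvg_dotv.
  exact: (cvgD l1 (cvgM (cvg_cst _) q)).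
have phic k : continuous (phi k).
  by case=> x y; apply: (phi_cvg _ _ (nbhs_filter _) k fst snd x y);
    [exact: cvg_fst|exact: cvg_snd].
have f1l : lower_semicontinuous (fun z : 'rV[R]_n * 'rV[R]_n => f z.1).
  by apply: (lsc_comp fl) => -[x y]; exact: cvg_fst.
have Kc : compact (B `*` (B `&` S)).
  by apply: compact_setX => //; exact: compact_closedI.
(* z k minimizes the decoupled problem with penalty k|x - y|^2. *)
have /choice[z zP] : forall k, exists z : 'rV[R]_n * 'rV[R]_n,
    (B `*` (B `&` S)) z /\ forall z', (B `*` (B `&` S)) z' ->
    (f z.1 + (phi k z)%:E <= f z'.1 + (phi k z')%:E)%E.
  move=> k; have [||z Kz zmin] := lsc_compact_min (lsc_addC _ f1l (phic k)) Kc.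
  - by move=> ?; exact: fN.
  - by exists (xb, xb).
  - by exists z.
have [G [GU Goo]] := ultraFilterLemma (F := \oo) _.
pose x k := (z k).1; pose y k := (z k).2.
have Bx k : B (x k) by have [[]] := zP k.
have [By Sy] : (forall k, B (y k)) /\ forall k, S (y k).
  by split=> k; have [[_ []]] := zP k.
have zmin k x' y' : B x' -> B y' -> S y' ->
    (f (x k) + (phi k (x k, y k))%:E <= f x' + (phi k (x', y'))%:E)%E.
  move=> ? ? ?; have [_ /(_ (x', y'))] := zP k.
  by rewrite /x /y; case: (z k) => ? ?; exact.
have [xs Bxs xxs] : exists2 p, B p & x @ G --> p.
  by apply: compact_ultra_cvg Bc _; exact: nearW.
have [ys BSys yys] : exists2 p, (B `&` S) p & y @ G --> p.
  apply: (@compact_ultra_cvg _ _ GU _ (B `&` S)); first exact: compact_closedI.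
  by apply: nearW => k; split.
pose a k := fine (f (x k)).
have zle k : (f (x k) + (phi k (x k, y k))%:E <= ab%:E)%E.
  apply: le_trans (zmin k xb xb Bxb Bxb Sxb) _.
  by rewrite /phi /l /= !subrr !dotv0r !mulr0 !addr0 fab.
have fa k : f (x k) = (a k)%:E.
  rewrite /a fineK // fin_numE -ltNye -ltey fN /= ltey.
  by apply/eqP => fx; have := zle k; rewrite fx.
have ale k : a k + phi k (x k, y k) <= ab.
  by have := zle k; rewrite fa -EFinD lee_fin.
(* Since f + <g, . - xb> is bounded below on B, so is k|x - y|^2 above. *)
have xys : xs = ys.
  have [x0 Bx0 x0min] :=
    lsc_compact_min (lsc_addC fN fl gc) Bc (ex_intro _ _ Bxb).
  have [m mE] : exists m : R, (f x0 + (dotv g (x0 - xb))%:E)%E = m%:E.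
    have := x0min _ Bxb; rewrite fab -EFinD; move: (fN x0).
    by case: (f x0) => // s _ _; exists (s + dotv g (x0 - xb)).
  have qle k : k%:R * dotv (x k - y k) (x k - y k) <= ab - m.
    have := x0min _ (Bx k); rewrite mE fa -EFinD lee_fin => mle.
    have := ale k; rewrite /phi /l /=.
    have := mulr_ge0 (addr_ge0 C0 ler01) (dotv_ge0 (x k - xb)).
    by move=> ? ?; lra.
  apply/eqP; rewrite -subr_eq0; apply/eqP; apply: dotv_eq0; apply/eqP.
  rewrite eq_le dotv_ge0 andbT leNgt; apply/negP; set d := dotv _ _ => d0.
  have qd : \forall k \near G, d / 2 < dotv (x k - y k) (x k - y k).
    apply: (cvgr_gt d); last by rewrite ltr_pdivrMr // ltr_pMr // ltr1n.
    exact: (cvg_dotv (cvgB xxs yys) (cvgB xxs yys)).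
  have kd : \forall k \near G, 2 * (ab - m) / d < k%:R.
    by apply: Goo; exact: nbhs_infty_gtr.
  have [k [/= qk]] := filter_ex (filterI qd kd).
  rewrite ltr_pdivrMr // => kk; have := qle k; set q := dotv _ _ in qk *.
  have k0 : 0 <= k%:R :> R by []; nra.
subst ys; have Sxs : S xs by case: BSys.
(* The limit does no worse than xb, and xb is a strict minimizer of f + l. *)
have xsb : xs = xb.
  have cl := @lsc_sublevel_closed _ _ _ ab (lsc_addC fN fl lc).
  have xsle : (f xs + (l xs)%:E <= ab%:E)%E.
    apply: (closed_cvg _ cl _ _ xxs); apply: nearW => k /=.
    rewrite fa -EFinD lee_fin; apply: le_trans (ale k); rewrite lerD2l.
    by rewrite /phi /= lerDl mulr_ge0 // dotv_ge0.
  apply/eqP; rewrite -subr_eq0; apply/eqP; apply: dotv_eq0; apply/eqP.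
  rewrite eq_le dotv_ge0 andbT.
  have := xbmin _ Bxs Sxs; move: xsle (fN xs); rewrite fab /l.
  by case: (f xs) => // s; rewrite -!EFinD !lee_fin; lra.
subst xs.
have aab : a @ G --> ab.
  apply/cvgrPdist_lt => e e0.
  have lG : \forall k \near G, - e < l (x k).
    apply: (cvgr_gt (l xb)); first exact: cvg_comp xxs (@lc xb).
    by rewrite /l subrr !dotv0r mulr0 addr0 oppr_lt0.
  have [|V Vxb aV] := fl xb (ab - e); first by rewrite fab lte_fin gtrBl.
  have VG : \forall k \near G, V (x k) by exact: xxs.
  apply: filterS2 lG VG => k lk /aV; rewrite fa lte_fin => ak /=.
  have := ale k; rewrite /phi /=.
  have := mulr_ge0 (ler0n R k) (dotv_ge0 (x k - y k)).
  by move=> ? ?; rewrite ltr_distl; apply/andP; split; lra.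
(* Minus the gradient in y, and the coupling part of the gradient in x, of
   the penalty. *)
pose w k := (2 * k%:R) *: (x k - y k).
have inB (u : 'rV[R]_n) : dotv (u - xb) (u - xb) < r -> \forall v \near u, B v.
  move=> ur; apply: filterS (cvgr_lt _ (@dotvB_continuous _ _ xb u) _ ur) => v.
  exact: ltW.
have xr : \forall k \near G, dotv (x k - xb) (x k - xb) < r.
  have := near_dotvB xb r0; exact: xxs.
have yr : \forall k \near G, dotv (y k - xb) (y k - xb) < r.
  have := near_dotvB xb r0; exact: yys.
(* Vary y alone. *)
have wS : \forall k \near G, S (y k) /\ regular_normal S (y k) (w k).
  apply: filterS yr => k /inB yB; split => //; rewrite -[w k]opprK.
  apply: (@regular_normal_quadratic _ _ _ _ _ k%:R).
  apply: filterS yB => y' By' Sy'; have := zmin k (x k) y' (Bx k) By' Sy'.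
  rewrite fa -!EFinD lee_fin lerD2l /phi /= lerD2l.
  have -> : x k - y' = (x k - y k) - (y' - y k) by rewrite opprB addrA subrK.
  rewrite /w dotvNl dotvZl; move: (x k - y k) (y' - y k) => u v.
  by rewrite !dotvE (dotvC v u); lra.
pose h k := g + w k + (2 * (C + 1)) *: (x k - xb).
(* Vary x alone, replacing the value of f by an arbitrary height above it. *)
have hE : \forall k \near G, epi f (row_mx (x k) (const_mx (a k))) /\
    regular_normal (epi f) (row_mx (x k) (const_mx (a k)))
      (row_mx (- h k) (const_mx (- 1))).
  apply: filterS xr => k /inB /nbhs_dotvB[e e0 eB]; split.
    by rewrite /epi /= row_mxKl row_mxKr mxE fa.
  have -> : row_mx (- h k) (const_mx (- 1)) =
      - row_mx (h k) (const_mx 1 : 'rV_1).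
    by rewrite opp_row_mx; congr row_mx; apply/rowP => i; rewrite !mxE.
  apply: (@regular_normal_quadratic _ _ _ _ _ (k%:R + C + 1)).
  apply: filterS (near_dotvB _ e0) => q.
  rewrite -[q]hsubmxK /epi /= row_mxKl row_mxKr.
  move: (lsubmx q) (rsubmx q) => x' a'.
  have -> : a' = const_mx (a' 0 0) by apply/rowP => i; rewrite !mxE !ord1.
  rewrite mxE; move: (a' 0 0) => {}a'.
  rewrite opp_row_mx add_row_mx.
  have -> : const_mx a' - const_mx (a k) = const_mx (a' - a k) :> 'rV_1.
    by apply/rowP => i; rewrite !mxE.
  rewrite !dotv_row_mx !dotv_const_mx mul1r => qe fx'.
  have Bx' : B x'.
    apply: eB; apply/ltW; apply: le_lt_trans qe.
    by rewrite lerDl -expr2 sqr_ge0.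
  have := zmin k x' (y k) Bx' (By k) (Sy k).
  have /= := leeD2r (phi k (x', y k))%:E fx' => le1 /le_trans /(_ le1).
  rewrite fa -!EFinD lee_fin /phi /l /h /w /=.
  have -> : x' - xb = (x k - xb) + (x' - x k) by rewrite [RHS]addrC addrA subrK.
  have -> : x' - y k = (x k - y k) + (x' - x k).
    by rewrite [RHS]addrC addrA subrK.
  have c0 : 0 <= (k%:R + C + 1) * (a' - a k) ^+ 2.
    by rewrite mulr_ge0 ?sqr_ge0 // !addr_ge0.
  move: c0; move: (x k - xb) (x' - x k) (x k - y k) => u d v.
  by rewrite !dotvE (dotvC d u) (dotvC d v) => *; lra.
(* The normalized pairs (w, 1) are bounded whether or not w is, and they do not
   tend to 0. *)
pose s k := (1 + `|w k|)^-1; pose p k := s k *: w k.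
have s0 k : 0 < s k by rewrite invr_gt0 ltr_wpDr.
have ps k : `|p k| + s k = 1.
  rewrite /p normrZ gtr0_norm // -[X in _ + X]mulr1 -mulrDr.
  by rewrite [_ + 1]addrC mulVf.
have [t t0 st] : exists2 t, `[0, 1]%classic t & s @ G --> (t : R).
  apply: compact_ultra_cvg; first exact: segment_compact.
  by apply: nearW => k /=; rewrite in_itv /= ltW //= -(ps k) lerDr.
have [om _ pom] : exists2 q, [set q : 'rV[R]_n | `|q| <= 1] q & p @ G --> q.
  apply: compact_ultra_cvg.
    apply: bounded_closed_compact.
      exists 1; split=> [|M M1 q /= q1]; first exact: num_real.
      exact: le_trans q1 (ltW M1).
    have /continuous_closedP cl := @norm_continuous _ 'rV[R]_n.
    exact: cl (@closed_le _ 1).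
  by apply: nearW => k /=; rewrite -(ps k) lerDl ltW.
have omt : `|om| + t = 1.
  have c1 : `|p k| + s k @[k --> G] --> `|om| + t.
    by apply: cvgD st; exact: cvg_norm.
  have c2 : `|p k| + s k @[k --> G] --> (1 : R).
    by under eq_cvg do rewrite ps; exact: cvg_cst.
  exact: (cvg_unique _ c1 c2).
have omS : limiting_normal S xb om.
  apply: (limiting_normal_cvg _ yys pom).
  apply: filterS wS => k [? ?]; split=> //.
  exact: regular_normalZ.
have omE : limiting_normal (epi f) (row_mx xb (const_mx ab))
    (row_mx (- (t *: g + om)) (const_mx (- t))).
  have vsE k : s k *: row_mx (- h k) (const_mx (- 1) : 'rV_1) =
      row_mx (- (s k *: g + p k + (s k * (2 * (C + 1))) *: (x k - xb)))
        (const_mx (- s k)).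
    rewrite scale_row_mx; congr row_mx; last first.
      by apply/rowP => i; rewrite !mxE mulrN1.
    rewrite scalerN /h (scalerDr _ (g + w k)) (scalerDr _ g).
    by rewrite (scalerA _ _ (x k - xb)).
  apply: (limiting_normal_cvg _ (cvg_row_mx_const xxs aab)
    (vs := fun k => s k *: row_mx (- h k) (const_mx (- 1)))).
    by apply: filterS hE => k [? ?]; split=> //; exact: regular_normalZ.
  under eq_cvg do rewrite vsE.
  apply: cvg_row_mx_const; last exact: cvgN.
  have -> : t *: g + om = t *: g + om + (t * (2 * (C + 1))) *: (xb - xb).
    by rewrite subrr scaler0 addr0.
  apply: cvgN; apply: cvgD; first by apply: cvgD => //; apply: cvgZr_tmp.
  by apply: cvgZ; [apply: cvgMr_tmp|exact: (cvgB xxs (cvg_cst _))].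
(* t = 0 is the unbounded case: - om would be a nonzero singular subgradient
   opposite to a normal of S. *)
have tn0 : t != 0.
  apply/eqP => t00; move: omE omt; rewrite t00 scale0r add0r oppr0 addr0 => omE.
  have /eqP : - om = 0 by apply: QC; split=> //=; rewrite opprK.
  rewrite oppr_eq0 => /eqP ->; rewrite normr0 => /esym /eqP.
  by rewrite oner_eq0.
have tp : 0 < t by move: t0; rewrite /= in_itv /= lt0r tn0 => /andP[].
have it0 : 0 < t^-1 by rewrite invr_gt0.
exists (t^-1 *: - (t *: g + om)), (t^-1 *: om); split.
- have := limiting_normalZ it0 omE; rewrite scale_row_mx /subdiff /=.
  have -> // : t^-1 *: const_mx (- t) = const_mx (- 1) :> 'rV_1.
  by apply/rowP => i; rewrite !mxE mulrN mulVf.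
- by apply: limiting_normalZ.
- by rewrite scalerN scalerDr scalerA mulVf // scale1r opprD addrNK addNr.
Qed.

End SumRule.

(** * Definable subsets of the line near infinity *)

Section Definability.
Context {R : realType}.
Local Notation oform := (ord.formula R).
Local Notation oholds := (@ord.holds R).
Local Notation tm := (GRing.term R).

Lemma eventually_sgr_horner (p : {poly R}) :
  exists s, \forall t \near +oo, Num.sg p.[t] = s.
Proof.
have [->|p0] := eqVneq p 0.
  by exists 0; apply: nearW => t; rewrite horner0 sgr0.
exists (polyrcf.sgp_pinfty p); near=> t.
apply: (polyrcf.sgp_pinftyP (polyrcf.ge_cauchy_bound p0)).
by rewrite in_itv /= andbT; near: t; apply: nbhs_pinfty_ge; exact: num_real.
Unshelve. all: by end_near. Qed.

Lemma eval_rterm_horner (u : tm) : GRing.rterm u ->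
  exists p : {poly R}, forall t, GRing.eval [:: t] u = p.[t].
Proof.
elim: u => //=.
- move=> [|i] _; first by exists 'X => t; rewrite hornerX.
  by exists 0 => t; rewrite horner0 /= nth_nil.
- by move=> c _; exists c%:P => t; rewrite hornerC.
- by move=> k _; exists k%:R%:P => t; rewrite hornerC.
- move=> u IHu v IHv /andP[/IHu[p pE] /IHv[q qE]].
  by exists (p + q) => t; rewrite hornerD pE qE.
- by move=> u IHu /IHu[p pE]; exists (- p) => t; rewrite hornerN pE.
- by move=> u IHu k /IHu[p pE]; exists (p *+ k) => t; rewrite hornerMn pE.
- move=> u IHu v IHv /andP[/IHu[p pE] /IHv[q qE]].
  by exists (p * q) => t; rewrite hornerM pE qE.
- by move=> u IHu k /IHu[p pE]; exists (p ^+ k) => t; rewrite horner_exp pE.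
Qed.

Lemma eventually_qf_eval (phi : oform) : ord.qf_form phi -> ord.rformula phi ->
  exists b, \forall t \near +oo, ord.qf_eval [:: t] phi = b.
Proof.
have cmp (P : R -> bool) (u v : tm) : GRing.rterm u && GRing.rterm v ->
    exists b, \forall t \near +oo,
      P (Num.sg (GRing.eval [:: t] v - GRing.eval [:: t] u)) = b.
  move=> /andP[/eval_rterm_horner[p pE] /eval_rterm_horner[q qE]].
  have [s sP] := eventually_sgr_horner (q - p); exists (P s).
  by apply: filterS sP => t <-; rewrite pE qE hornerD hornerN.
have bin (op : bool -> bool -> bool) (P Q : R -> bool) :
    (exists b, \forall t \near +oo, P t = b) ->
    (exists b, \forall t \near +oo, Q t = b) ->
    exists b, \forall t \near +oo, op (P t) (Q t) = b.
  move=> [b bP] [c cQ]; exists (op b c).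
  by apply: filterS2 bP cQ => t -> ->.
elim: phi => //=.
- by move=> b _ _; exists b; exact: nearW.
- move=> u v _ /(cmp (fun s => s == 0))[b bP]; exists b.
  by apply: filterS bP => t <-; rewrite sgr_cp0 subr_eq0 eq_sym.
- move=> u v _ /(cmp (fun s => s == 1))[b bP]; exists b.
  by apply: filterS bP => t <-; rewrite sgr_cp0 subr_gt0.
- move=> u v _ /(cmp (fun s => s != -1))[b bP]; exists b.
  by apply: filterS bP => t <-; rewrite sgr_cp0 subr_lt0 leNgt.
- move=> f IHf g IHg /andP[? ?] /andP[? ?].
  by apply: bin andb _ _ (IHf _ _) (IHg _ _).
- move=> f IHf g IHg /andP[? ?] /andP[? ?].
  by apply: bin orb _ _ (IHf _ _) (IHg _ _).
- move=> f IHf g IHg /andP[? ?] /andP[? ?].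
  by apply: bin implb _ _ (IHf _ _) (IHg _ _).
- move=> f IHf qf rf; have [b bP] := IHf qf rf; exists (~~ b).
  by apply: filterS bP => t ->.
Qed.

(** Quantifier elimination reduces to a Boolean combination of sign conditions
    on univariate polynomials, and each of these is eventually constant. *)
Lemma eventually_holds (phi : oform) :
  exists b : bool, \forall t \near +oo, oholds [:: t] phi <-> b.
Proof.
have /andP[qf rf] := ord.quantifier_elim_wf (@qe_rcf.wf_QE_wproj R)
  (ord.to_rform_rformula phi).
have [b bP] := eventually_qf_eval qf rf; exists b.
by apply: filterS bP => t <-; apply: rwP; exact: qe_rcf.rcf_satP.
Qed.

Lemma holds_foldr_Exists (I : seq nat) e (phi : oform) :
  oholds e (foldr ord.Exists phi I) <->
  exists2 e', {in [predC I], nth 0 e =1 nth 0 e'} & oholds e' phi.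
Proof.
elim: I e => [|i I IHI] e /=.
  split=> [|[e' ee']]; first by exists e.
  by apply: ord.eq_holds => i; rewrite ee'.
split=> [[x /IHI[e' ee' ephi]]|[e' ee' ephi]].
  exists e' => // j; rewrite !inE negb_or => /andP[ji jI].
  by have := ee' j jI; rewrite nth_set_nth /= (negPf ji).
exists (nth 0 e' i); apply/IHI; exists e' => // j jI.
rewrite nth_set_nth /=; case: eqVneq => [->//|ji].
by apply: ee'; rewrite !inE negb_or ji.
Qed.

Definition mpoly_term N (V : 'I_N -> tm) (p : mpoly.mpoly N R) : tm :=
  foldr (fun m u => GRing.Add (GRing.Mul (GRing.Const (mpoly.mcoeff m p))
      (foldr (fun i v => GRing.Mul (GRing.Exp (V i) (mpoly.fun_of_multinom m i)) v)
         (GRing.Const 1) (index_enum 'I_N))) u)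
    (GRing.Const 0) (mpoly.msupp p).

Lemma eval_mpoly_term N (V : 'I_N -> tm) p e :
  GRing.eval e (mpoly_term V p) = mpoly.meval (fun i => GRing.eval e (V i)) p.
Proof.
rewrite mpoly.mevalE /mpoly_term; elim: (mpoly.msupp p) => [|m s IHs] /=.
  by rewrite big_nil.
rewrite big_cons IHs; congr (_ * _ + _).
elim: (index_enum _) => [|i r IHr] /=; first by rewrite big_nil.
by rewrite big_cons IHr.
Qed.

(** Substituting the terms V for the coordinates leaves room for parameters,
    which become constants, and for variables shared between several sets. *)
Lemma semialgebraic_formula N (A : set 'rV[R]_N) (V : 'I_N -> tm) :
  semialgebraic A ->
  exists phi : oform, forall e,
    oholds e phi <-> A (\row_j GRing.eval e (V j)).
Proof.
move=> [L ->].
pose Feq p phi : oform :=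
  ord.And (ord.Equal (mpoly_term V p) (GRing.Const 0)) phi.
pose Flt p phi : oform :=
  ord.And (ord.Lt (GRing.Const 0) (mpoly_term V p)) phi.
pose F sys phi : oform := ord.Or
  (ord.And (foldr Feq (ord.Bool true) sys.1) (foldr Flt (ord.Bool true) sys.2)) phi.
exists (foldr F (ord.Bool false) L) => e; set x := \row_j _.
have evE p : GRing.eval e (mpoly_term V p) = mpoly.meval (fun i => x 0 i) p.
  rewrite eval_mpoly_term !mpoly.mevalE; apply: eq_bigr => m _; congr (_ * _).
  by apply: eq_bigr => i _; rewrite mxE.
have eqP' s : oholds e (foldr Feq (ord.Bool true) s) <->
    all (fun p => mpoly.meval (fun i => x 0 i) p == 0) s.
  elim: s => //= p s IHs; rewrite evE IHs.
  by split=> [[-> ->]|/andP[/eqP -> ->]] //; rewrite eqxx.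
have ltP' s : oholds e (foldr Flt (ord.Bool true) s) <->
    all (fun p => 0 < mpoly.meval (fun i => x 0 i) p) s.
  elim: s => //= p s IHs; rewrite evE IHs.
  by split=> [[-> ->]|/andP[-> ->]].
rewrite /=; elim: L => //= sys L IHL; rewrite IHL eqP' ltP'.
by rewrite -(rwP orP) -(rwP andP).
Qed.

(** A is meant to be the graph of a family of curves, with parameter a and time
    t, and G the graph of a function: the statement is about the values of the
    function along one curve. Projecting out the point x of the curve and the
    value y is where quantifier elimination is needed. *)
Lemma semialgebraic_curve_eventually m n (A : set 'rV[R]_(m + 1 + n))
    (G : set 'rV[R]_(n + 1)) (a : 'rV[R]_m) (c : R) :
  semialgebraic A -> semialgebraic G ->
  exists b : bool, \forall t \near +oo,
    (exists x y, [/\ A (row_mx (row_mx a (const_mx t)) x),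
                     G (row_mx x (const_mx y)) & y < c]) <-> b.
Proof.
move=> Asa Gsa.
(* Variable 0 is t, variables 1 to n are x, and variable n + 1 is y. *)
pose VA (j : 'I_(m + 1 + n)) : tm := match fintype.split j with
  | inl k => match fintype.split k with
             | inl i => GRing.Const (a 0 i) | inr _ => GRing.Var _ 0 end
  | inr i => GRing.Var _ i.+1 end.
pose VG (j : 'I_(n + 1)) : tm := match fintype.split j with
  | inl i => GRing.Var _ i.+1 | inr _ => GRing.Var _ n.+1 end.
have [phiA phiAP] := semialgebraic_formula VA Asa.
have [phiG phiGP] := semialgebraic_formula VG Gsa.
pose X (e : seq R) : 'rV[R]_n := \row_i e`_i.+1.
have rowA e :
    \row_j GRing.eval e (VA j) = row_mx (row_mx a (const_mx e`_0)) (X e).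
  apply/rowP => j; rewrite !mxE /VA.
  case: (fintype.split j) => k; rewrite !mxE //.
  by case: (fintype.split k) => i; rewrite ?mxE.
have rowG e : \row_j GRing.eval e (VG j) = row_mx (X e) (const_mx e`_n.+1).
  apply/rowP => j; rewrite !mxE /VG.
  by case: (fintype.split j) => k; rewrite !mxE.
pose psi : oform := foldr ord.Exists
  (ord.And phiA (ord.And phiG (ord.Lt (GRing.Var _ n.+1) (GRing.Const c))))
  (iota 1 n.+1).
have [b bP] := eventually_holds psi; exists b; apply: filterS bP => t <-.
rewrite /psi holds_foldr_Exists; split.
  move=> [x [y [Ax Gx yc]]].
  pose s := rcons [seq x 0 i | i <- enum 'I_n] y.
  have Xs : X (t :: s) = x.
    apply/rowP => i; rewrite !mxE /= nth_rcons size_map size_enum_ord ltn_ord.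
    by rewrite (nth_map i) ?size_enum_ord // nth_ord_enum.
  have ys : (t :: s)`_n.+1 = y.
    by rewrite /= nth_rcons size_map size_enum_ord ltnn eqxx.
  exists (t :: s) => [[|j]|] //.
    rewrite inE mem_iota /= nth_nil -leqNgt => jn; rewrite nth_default //.
    by rewrite size_rcons size_map size_enum_ord.
  split; first by apply/phiAP; rewrite rowA Xs.
  split; first by apply/phiGP; rewrite rowG Xs ys.
  by change ((t :: s)`_n.+1 < c); rewrite ys.
move=> [e et [/phiAP + [/phiGP + yc]]]; rewrite rowA rowG => Ae Ge.
exists (X e), e`_n.+1; split => //.
by have := et 0%N; rewrite !inE mem_iota /= => ->.
Qed.

End Definability.

(** * Branches at infinity and their limit values *)

Section Limits.
Context {R : realType}.

(** The limit is the supremum of the levels c above which g eventually stays: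
    every larger level is eventually strictly above g. *)
Lemma eventually_decided_cvg (g : R -> R) :
  (forall c, exists b : bool, \forall t \near +oo, g t < c <-> b) ->
  cvg ((g t)%:E @[t --> +oo]).
Proof.
move=> dec; pose A := [set c | \forall t \near +oo, c <= g t].
have decA c : A c \/ \forall t \near +oo, g t < c.
  have [[|] bP] := dec c; [right|left].
    by apply: filterS bP => t ->.
  by apply: filterS bP => t gc; rewrite leNgt; apply/negP => /gc.
have [[c0 Ac0]|nA] := pselect (A !=set0); last first.
  apply/cvg_ex; exists -oo%E; apply/cvgeNyPlt => c.
  have [Ac|] := decA c; first by case: nA; exists c.
  by apply: filterS => t; rewrite lte_fin.
have [Aub|nub] := pselect (has_ubound A); last first.
  apply/cvg_ex; exists +oo%E; apply/cvgeyPge => c.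
  have [Ac|gc] := decA c; first by apply: filterS Ac => t; rewrite lee_fin.
  case: nub; exists c => d Ad; have [t [/= dt tc]] := filter_ex (filterI Ad gc).
  exact: ltW (le_lt_trans dt tc).
have supA : has_sup A by split => //; exists c0.
apply/cvg_ex; exists (sup A)%:E; apply/fine_cvgP; split; first exact: nearW.
apply/cvgrPdist_lt => e e0.
have [a Aa ea] := sup_adherent e0 supA.
have [Ae|ge] := decA (sup A + e).
  by have := sup_upper_bound supA Ae; rewrite gerDl leNgt e0.
apply: filterS2 Aa ge => t at1 te /=.
by rewrite ltr_distl; apply/andP; split; lra.
Qed.

Context {n : nat} {f : 'rV[R]_n -> \bar R} {S : set 'rV[R]_n}.
Context (D : decomposition_at_infinity f S).

Lemma component_point k : exists i a, fibre (d := D) i a /\ component D k a.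
Proof.
have : range (component D) (component D k) by exists k.
rewrite component_range => -[i _ [a ia kE]]; exists i, a; split=> //.
by rewrite -kE; exact: connected_component_refl.
Qed.

Lemma tangency_point_branch x : tangency_variety f S x ->
  base_radius D < enorm x -> exists k, tangency_branch D k x.
Proof.
move=> Gx xr; have [[_ _ surj] _ _] := triv_homeomorphism D.
have [|[a t] [[i _ ia] /= tr] xE] := surj x.
  by split=> //; apply/negP; rewrite -ltNge.
have : range (component D) (connected_component (fibre (d := D) i) a).
  by rewrite component_range; exists i => //; exists a.
move=> [k _ kE]; exists k, (a, t) => //; split=> //=.
by rewrite kE; exact: connected_component_refl.
Qed.

Lemma triv_branch_point k i a t : fibre (d := D) i a -> component D k a ->
  base_radius D < t ->
  [/\ tangency_branch D k (triv D (a, t)), enorm (triv D (a, t)) = t &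
      tangency_variety f S (triv D (a, t))].
Proof.
move=> ia ka tr; have ut : (\bigcup_i fibre (d := D) i) a by exists i.
split.
- by exists (a, t) => //; split=> //=; rewrite in_itv /= tr.
- exact: triv_norm.
- have [[sub _ _] _ _] := triv_homeomorphism D.
  by have [|//] := sub (a, t); split=> //=; rewrite in_itv /= tr.
Qed.

(** All points of a branch at distance t have the same value, so the
    semialgebraic curve through a single point of the component carries all the
    values of fk. *)
Lemma branch_value_cvg (fk : R -> R) k :
  semialgebraic_efun f ->
  (forall t x, base_radius D < t -> (tangency_branch D k `&` esphere t) x ->
     f x = (fk t)%:E) ->
  cvg ((fk t)%:E @[t --> +oo]).
Proof.
move=> fsa fkE; apply: eventually_decided_cvg => c.
have [i [a [ia ka]]] := component_point k.
have [b bP] := semialgebraic_curve_eventually a c (triv_semialgebraic D) fsa.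
exists b.
have tr : \forall t \near +oo, base_radius D < t.
  by apply: nbhs_pinfty_gt; exact: num_real.
apply: filterS2 bP tr => t <- tr.
have [ht hn _] := triv_branch_point ia ka tr.
have fE := fkE t _ tr (conj ht hn).
split=> [fc|[x [y [[[a' t'] _] /= /eq_row_mx[/eq_row_mx[-> tE] <-]]]]].
  exists (triv D (a, t)), (fk t); split => //.
    exists (a, t) => //; split=> //=; last by rewrite in_itv /= tr.
    by exists i.
  by rewrite /= row_mxKl row_mxKr mxE.
have -> : t' = t by move/rowP : tE => /(_ 0); rewrite !mxE.
by rewrite /= row_mxKl row_mxKr mxE fE => -[->].
Qed.

End Limits.

(** * Tangency points with small values *)

Section Descent.
Context {R : realType}.
Context (n : nat) (f : 'rV[R]_n -> \bar R) (S : set 'rV[R]_n).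
Context (fN : forall x, (-oo < f x)%E) (fl : lower_semicontinuous f).
Context (Sc : closed S) (QC : qualification f S).

(** The map s |-> max(s, 0)^2 has derivative 2 max(s, 0), which is Lipschitz
    with constant 2. *)
Lemma sqr_maxr0_quadratic (s s' : R) :
  Num.max s' 0 ^+ 2 <=
    Num.max s 0 ^+ 2 + 2 * Num.max s 0 * (s' - s) + (s' - s) ^+ 2.
Proof.
have [s0|s0] := leP s 0; have [s1|s1] := leP s' 0.
- by have := sqr_ge0 (s' - s); lra.
- have := mulr_ge0 (_ : 0 <= - s) (ltW s1); rewrite oppr_ge0 => /(_ s0).
  by have := sqr_ge0 s; lra.
- by have := sqr_ge0 s'; lra.
- by lra.
Qed.

(** A penalty that is radial, vanishes at y and grows beyond |y| keeps the
    minimizer away from the boundary of a ball without raising its value above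
    f y; its gradient is the multiple of x allowed by tangency. *)
Lemma tangency_point_below (y : 'rV[R]_n) (c : R) : S y -> (f y < c%:E)%E ->
  exists2 x, tangency_variety f S x & (f x < c%:E)%E.
Proof.
move=> Sy fyc; pose a := dotv y y.
pose B := [set x : 'rV[R]_n | dotv (x - 0) (x - 0) <= a + 1].
have BSc : compact (B `&` S).
  by apply: compact_closedI => //; exact: compact_dotvB.
have BSy : (B `&` S) y by split=> //; rewrite /B /= subr0 lerDl.
have [x0 _ x0min] := lsc_compact_min fl BSc (ex_intro _ y BSy).
have [fy fyE] : exists r : R, f y = r%:E.
  by move: fyc (fN y); case: (f y) => // r; exists r.
have [m mE] : exists m : R, f x0 = m%:E.
  by move: (x0min _ BSy) (fN x0); rewrite fyE; case: (f x0) => // r; exists r.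
have mfy : m <= fy by have := x0min _ BSy; rewrite fyE mE lee_fin.
(* The penalty equals K where |x|^2 = a + 1, which exceeds fy - m. *)
pose K := fy - m + 1.
pose M (x : 'rV[R]_n) := Num.max (dotv x x - a) 0.
have penc : continuous (fun x : 'rV[R]_n => K * M x ^+ 2).
  move=> x.
  have xx : dotv z z @[z --> x] --> dotv x x.
    exact: (@cvg_dotv _ _ (nbhs x) _ _ id id x x cvg_id cvg_id).
  have Mc : M z @[z --> x] --> M x.
    apply: (@continuous_max R 'rV[R]_n (fun z => dotv z z - a) (fun=> 0)).
      exact: cvgB xx (cvg_cst _).
    exact: cst_continuous.
  exact: (cvgM (cvg_cst K) (cvgM Mc Mc)).
have [x [Bx Sx] xmin] := lsc_compact_min (lsc_addC fN fl penc) BSc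
  (ex_intro _ y BSy).
have My : M y = 0 by rewrite /M subrr maxxx.
have M0 : 0 <= M x by rewrite le_max lexx orbT.
have xley := xmin _ BSy; rewrite My expr0n mulr0 fyE -EFinD addr0 in xley.
have [fx fxE] : exists r : R, f x = r%:E.
  by move: xley (fN x); case: (f x) => // r; exists r.
rewrite fxE -EFinD lee_fin in xley.
have K1 : 1 <= K by rewrite /K; lra.
have mfx : m <= fx by have := x0min x (conj Bx Sx); rewrite fxE mE lee_fin.
have xa : dotv x x < a + 1.
  rewrite lt_neqAle; move: Bx; rewrite /B /= subr0 => ->; rewrite andbT.
  apply/eqP => xa; move: xley; rewrite /M xa addrAC subrr add0r.
  by rewrite max_l // expr1n mulr1 /K; lra.
exists x; last first.
  rewrite fxE; apply: le_lt_trans fyc; rewrite fyE lee_fin.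
  by apply: le_trans xley; rewrite lerDl mulr_ge0 ?sqr_ge0 //; lra.
(* With s = |x|^2 - a and d = y' - x, the increment of s is 2<x,d> + |d|^2; its
   square is at most (8|x|^2 + 2)|d|^2 when |d| <= 1. *)
pose C := K * (2 * M x + 8 * dotv x x + 2).
have xdom : edom f x by rewrite /edom /= fxE ltry.
have [|||u [v [fu Sv uv0]]] :=
  @subdiff_sum_rule _ _ f S x ((4 * K * M x) *: x) C fN fl Sc xdom Sx.
- by rewrite QC.
- by have := dotv_ge0 x; rewrite /C => ?; apply: mulr_ge0; lra.
- have By' : \forall y' \near x, dotv (y' - 0) (y' - 0) < a + 1.
    by apply: (cvgr_lt _ (@dotvB_continuous _ _ 0 x)); rewrite subr0.
  apply: filterS2 By' (near_dotvB x ltr01) => y' /ltW By' y'x Sy'.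
  have := xmin _ (conj By' Sy'); rewrite fxE.
  case: (f y') (fN y') => [fy'| |] // _; last first.
    by move=> _; rewrite addye // leey.
  rewrite -!EFinD !lee_fin dotvZl.
  have := sqr_maxr0_quadratic (dotv x x - a) (dotv y' y' - a).
  rewrite -/(M y') -/(M x) /C; move: (M y') => My'.
  have -> : y' = x + (y' - x) by rewrite addrC subrK.
  rewrite [x + _ - x]addrC addKr; move: (y' - x) y'x => d d1.
  have := cauchy_schwarz x d; have := dotv_ge0 d.
  rewrite !dotvE (dotvC d x); set X := dotv x d; set d2 := dotv d d.
  set N := dotv x x; move: (M x) M0 => Mx M0 d0 cs pen le1; rewrite -/d2 in d1.
  have h1 : (2 * X + d2) ^+ 2 <= (8 * N + 2) * d2.
    have := sqr_ge0 (2 * X - d2); have := ler_wpM2l d0 (ltW d1).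
    by move=> ? ?; lra.
  have h2 : My' ^+ 2 <= Mx ^+ 2 + 2 * Mx * (2 * X + d2) + (8 * N + 2) * d2.
    apply: le_trans pen _; rewrite (_ : _ - a - _ = 2 * X + d2); last by ring.
    by rewrite lerD2l.
  have K0 : 0 <= K by lra.
  by have := ler_wpM2l K0 h2; lra.
by split=> //; exists (4 * K * M x), u, v; split.
Qed.

(** Otherwise the tangency points with values close to the infimum would all lie
    in one ball; the minimizer of f on S in that ball would then be a minimizer
    on S, hence critical. *)
Lemma far_tangency_point_below (r c : R) :
  let i := ereal_inf [set f x | x in S] in
  (forall z, critical_points f S z -> (i < f z)%E) -> (i < c%:E)%E ->
  exists x, [/\ tangency_variety f S x, r < enorm x & (f x < c%:E)%E].
Proof.
move=> i crit ic; apply: contrapT => nfar.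
have near_pt d : (i < d%:E)%E ->
    exists x, [/\ S x, edom f x, (f x < d%:E)%E & enorm x <= r].
  move=> id; have [_ [y Sy <-] fy] : exists2 z, [set f x | x in S] z &
      (z < (Num.min c d)%:E)%E.
    by apply: ereal_inf_lt; rewrite /Num.min; case: ifP.
  have [x Gx fx] := tangency_point_below Sy fy.
  have [fc fd] : (f x < c%:E)%E /\ (f x < d%:E)%E.
    by split; apply: lt_le_trans fx _; rewrite lee_fin ge_min lexx ?orbT.
  have [? ?] : S x /\ edom f x by case: Gx.
  exists x; split=> //; rewrite leNgt; apply/negP => rx; apply: nfar.
  by exists x; split.
have [z [Sz _ _ zr]] := near_pt c ic.
have r0 : 0 <= r by apply: le_trans zr; exact: sqrtr_ge0.
pose B := [set x : 'rV[R]_n | dotv (x - 0) (x - 0) <= r ^+ 2].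
have BSc : compact (B `&` S).
  by apply: compact_closedI => //; exact: compact_dotvB.
have BE x : enorm x <= r -> B x by rewrite enorm_le // /B /= subr0.
have [x [_ Sx] xmin] : exists2 x, (B `&` S) x &
    forall y, (B `&` S) y -> (f x <= f y)%E.
  by apply: lsc_compact_min => //; exists z; split => //; exact: BE.
have xi : (f x <= i)%E.
  rewrite leNgt; apply/negP => /ereal_lt_between[d id dx].
  have [w [Sw _ wd wr]] := near_pt d id.
  have := lt_trans dx (le_lt_trans (xmin _ (conj (BE _ wr) Sw)) wd).
  by rewrite ltxx.
have fx : edom f x by exact: le_lt_trans xi (lt_trans ic (ltry _)).
suff /crit : critical_points f S x by rewrite ltNge xi.
have [|||u [v [fu Sv]]] := @subdiff_sum_rule _ _ f S x 0 0 fN fl Sc fx Sx.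
- by rewrite QC.
- by [].
- apply: (@nearW _ (nbhs x)) => y Sy; rewrite mul0r addr0 dotvC dotv0r adde0.
  by apply: le_trans xi _; apply: ereal_inf_lbound; exists y.
by rewrite addr0 => uv; split=> //; exists u, v.
Qed.

End Descent.

Theorem theorem4p3 (R : realType) (n : nat) (f : 'rV[R]_n -> \bar R)
  (S : set 'rV[R]_n)
  (f_gtNy : forall x, (-oo < f x)%E)
  (f_lsc : lower_semicontinuous f)
  (f_semialgebraic : semialgebraic_efun f)
  (S_closed : closed S)
  (S_semialgebraic : semialgebraic S)
  (dom_nonempty : (edom f `&` S) !=set0)
  (dom_unbounded : forall r : R, ~ (edom f `&` S `<=` eball r))
  (QC : qualification f S)
  (D : decomposition_at_infinity f S)
  (fk : 'I_(components D) -> R -> R)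
  (fkE : forall (k : 'I_(components D)) (t : R) (x : 'rV[R]_n),
     base_radius D < t -> (tangency_branch D k `&` esphere t) x -> f x = (fk k t)%:E) :
  ereal_inf [set f x | x in S] =
  mine (ereal_inf [set f x | x in critical_points f S])
       (\big[mine/+oo%E]_(k < components D) lim ((fk k t)%:E @[t --> +oo])).
Proof.
set i := ereal_inf [set f x | x in S].
have iS x : S x -> (i <= f x)%E by move=> Sx; apply: ereal_inf_lbound; exists x.
have fk_cvg k : cvg ((fk k t)%:E @[t --> +oo]).
  exact: branch_value_cvg f_semialgebraic (fkE k).
apply/eqP; rewrite eq_le; apply/andP; split.
  rewrite le_min; apply/andP; split.
    by apply/ereal_infP => _ [x [_ Sx _] <-]; exact: iS.
  apply/bigmin_geP; split; first exact: leey.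
  move=> k _; apply: lime_ge; first exact: fk_cvg.
  have tr : \forall t \near +oo, base_radius D < t.
    by apply: nbhs_pinfty_gt; exact: num_real.
  apply: filterS tr => t tr; have [j [a [ja ka]]] := component_point k.
  have [br nt [_ Sx _]] := triv_branch_point ja ka tr.
  by rewrite -(fkE k t _ tr (conj br nt)); exact: iS.
rewrite leNgt; apply/negP; rewrite lt_min => /andP[i_crit i_lim].
have crit z : critical_points f S z -> (i < f z)%E.
  by move=> Sz; apply: lt_le_trans i_crit _; apply: ereal_inf_lbound; exists z.
have [c ic /bigmin_gtP[_ c_lim]] := ereal_lt_between i_lim.
have : \forall t \near +oo, forall k, (c%:E < (fk k t)%:E)%E.
  apply: filter_forall => k.
  exact: (fk_cvg k _ (open_ereal_gt' (c_lim k isT))).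
move=> [M [_ cM]].
have [x [Gx xr fxc]] := far_tangency_point_below f_gtNy f_lsc S_closed QC
  (Num.max M (base_radius D)) crit ic.
move: xr; rewrite gt_max => /andP[xM xr].
have [k xk] := tangency_point_branch Gx xr.
have fxE := fkE k (enorm x) x xr (conj xk erefl).
by have := cM _ xM k; rewrite -fxE ltNge (ltW fxc).
Qed.
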